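(* Let $K$ be a Polish space and let $F\in B_1(K)$. Then $F$ is a uniform limit on $K$ of a sequence of step functions. Hence $\mathrm{DSC}(K)$ is uniformly dense in $B_1(K)$, i.e. for every $f\in B_1(K)$ and $\varepsilon>0$ there is $g\in \mathrm{DSC}(K)$ with $\sup_{x\in K}|f(x)-g(x)|\le\varepsilon$.
   Context: $C(K)$ is the class of continuous functions $K\to\mathbb{R}$. $B_1(K)$ is the class of functions $f:K\to\mathbb{R}$ that are pointwise limits of sequences in $C(K)$. A function $F\in B_1(K)$ is a step function if $F(K)$ is discrete, meaning that no point of $F(K)$ is a cluster point of $F(K)$. $\mathrm{DSC}(K)$ is the set of $f:K\to\mathbb{R}$ for which there is a sequence $(f_n)\subset C(K)$ with $f_n\to f$ pointwise and $\sum_{n=1}^\infty|f_{n+1}(k)-f_n(k)|<\infty$ for every $k\in K$ (equivalently, the differences of two real-valued semi-continuous functions on $K$). *)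

(* Defs.v *)
From HB Require Import structures.
From mathcomp Require Import all_boot all_order all_algebra.
From mathcomp Require Import all_classical all_reals all_analysis.

Set Implicit Arguments.
Unset Strict Implicit.
Unset Printing Implicit Defensive.

Import Order.TTheory GRing.Theory Num.Theory.
Import numFieldNormedType.Exports.

Local Open Scope classical_set_scope.
Local Open Scope ring_scope.

Definition is_metric (R : realType) (T : Type) (d : T -> T -> R) : Prop :=
  [/\ forall x y, 0 <= d x y,
      forall x y, d x y = 0 <-> x = y,
      forall x y, d x y = d y x
    & forall x y z, d x z <= d x y + d y z].

Definition metrizes (R : realType) (K : topologicalType) (d : K -> K -> R) :
    Prop :=
  is_metric d /\
  forall (x : K) (A : set K),
    nbhs x A <-> exists2 e : R, 0 < e & [set y | d x y < e] `<=` A.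

(* Meant for a [d] that metrizes [K], so that convergence in [K] is
   convergence with respect to [d]. *)
Definition complete_metric (R : realType) (K : topologicalType)
    (d : K -> K -> R) : Prop :=
  forall u : nat -> K,
    (forall e : R, 0 < e ->
       exists N : nat, forall m n : nat,
         (N <= m)%N -> (N <= n)%N -> d (u m) (u n) < e) ->
    exists l : K, u @ \oo --> l.

Definition separable (K : topologicalType) : Prop :=
  exists2 D : set K, countable D & dense D.

(* Only the topology of [K] is fixed; the metric is existentially quantified,
   and [K] may be empty. *)
Definition polish (R : realType) (K : topologicalType) : Prop :=
  separable K /\ exists2 d : K -> K -> R, metrizes d & complete_metric d.

Definition baire_one (R : realType) (K : topologicalType) (f : K -> R) : Prop :=
  exists2 f_ : nat -> K -> R,
    forall n, continuous (f_ n) & forall k, f_ n k @[n --> \oo] --> f k.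

Definition discrete_subset (T : topologicalType) (A : set T) : Prop :=
  forall y, A y -> ~ limit_point A y.

Definition step_function (R : realType) (K : topologicalType) (F : K -> R) :
    Prop :=
  baire_one F /\ discrete_subset (range F).

Definition DSC (R : realType) (K : topologicalType) (f : K -> R) : Prop :=
  exists f_ : nat -> K -> R,
    [/\ forall n, continuous (f_ n),
        forall k, f_ n k @[n --> \oo] --> f k
      & forall k, (\sum_(0 <= n <oo) (`|f_ n.+1 k - f_ n k|)%:E < +oo)%E].

(* Main.v *)
Require Import Defs.
From HB Require Import structures.
From mathcomp Require Import all_boot all_order all_algebra.
From mathcomp Require Import all_classical all_reals all_analysis.

(** Both halves come from one construction, which works on every topological
    space.  Let [F] be the pointwise limit of continuous [f_ n] and let [e > 0].
    For an integer [j] and a natural number [N], the set [Z(j, N)] of the points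
    [x] with [`|f_ n x - j e| <= e] for all [n >= N] is a countable intersection
    of zero sets of continuous functions.  These countably many sets cover the
    space, and [`|F - j e| <= e] on [Z(j, N)].  Enumerate them as [Z_0, Z_1, ...]
    with values [c_0, c_1, ...] in [e Z], and let [G x = c_i] for the first [i]
    such that [x] lies in [Z_i].  Then [`|F - G| <= e], and the range of [G] is
    discrete because it lies in [e Z].

    The function [G] is more than Baire one.  Each [Z_i] carries continuous
    cutoffs [phi_i,n] that equal [1] on [Z_i] and vanish for large [n] at every
    point off [Z_i]; hence
    [sum_(i < n) c_i phi_i,n prod_(j < i) (1 - phi_j,n)] is a sequence of
    continuous functions that, at every point, is eventually equal to [G]
    ([discrete_limit_first_value]).  A sequence which is pointwise eventually
    constant converges pointwise and has finite pointwise variation, so [G] is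
    both a step function and a member of [DSC]. *)

Set Implicit Arguments.
Unset Strict Implicit.

Import Order.TTheory GRing.Theory Num.Theory.
Import numFieldNormedType.Exports.

Local Open Scope classical_set_scope.
Local Open Scope ring_scope.

(** * Pointwise eventually constant limits *)

(** [g] is the discrete limit of continuous functions: at each point the
    approximating sequence is eventually equal to the value of [g]. *)
Definition discrete_limit (R : realType) (K : topologicalType) (g : K -> R) :
    Prop :=
  exists2 g_ : nat -> K -> R,
    forall n, continuous (g_ n) & forall x, \forall n \near \oo, g_ n x = g x.

Lemma discrete_limit_baire_one (R : realType) (K : topologicalType)
    (g : K -> R) : discrete_limit g -> baire_one g.
Proof.
by case=> g_ g_cont g_lim; exists g_ => // x; apply: cvg_near_cst; exact: g_lim.
Qed.

Lemma discrete_limit_DSC (R : realType) (K : topologicalType) (g : K -> R) :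
  discrete_limit g -> DSC g.
Proof.
case=> g_ g_cont g_lim; exists g_; split=> // x.
  by apply: cvg_near_cst; exact: g_lim.
have [N _ gN] := g_lim x.
rewrite (nneseries_split 0 N); last by move=> k _; rewrite lee_fin.
rewrite eseries0 => [|i /= Ni _].
  by rewrite adde0 sumEFin ltry.
by rewrite !gN//= ?subrr ?normr0// (leq_trans Ni).
Qed.

(** * Selecting the value of the first closed set that contains a point *)

(** If [phi] is the indicator sequence of membership of a point in sets
    [Z_0, Z_1, ...], this is the value [c i] of the first [Z_i] with [i < m] that
    contains the point, and [0] if there is none; it is polynomial in [phi],
    hence continuous when the [phi i] are continuous functions. *)
Definition first_value_sum (R : realType) (c phi : nat -> R) (m : nat) : R :=
  \sum_(i < m) c i * phi i * \prod_(j < i) (1 - phi j).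

Lemma first_value_sumE (R : realType) (c phi : nat -> R) (i m : nat) :
  (i < m)%N -> phi i = 1 -> (forall j, (j < i)%N -> phi j = 0) ->
  first_value_sum c phi m = c i.
Proof.
move=> im phi1 phi0; rewrite /first_value_sum (bigD1 (Ordinal im))//=.
rewrite phi1 mulr1 big1 ?mulr1 => [|j _]; last by rewrite phi0 ?subr0.
rewrite big1 ?addr0// => j jNi.
have [ji|ij|ji] := ltngtP j i.
- by rewrite phi0// mulr0 mul0r.
- by rewrite (bigD1 (Ordinal ij))//= phi1 subrr mul0r mulr0.
- by move: jNi; rewrite -val_eqE /= ji eqxx.
Qed.

(** The cutoffs of the common zero set of nonnegative functions [h 0, h 1, ...]:
    they equal [1] on that set, and at any other point they vanish for large [n].
    Only finitely many [h k] enter at stage [n], so that continuity is preserved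
    without any convergence of the series of the [h k]. *)
Definition cutoff (R : realType) (K : Type) (h : nat -> K -> R) (n : nat)
    (x : K) : R :=
  Num.max 0 (1 - n%:R * \sum_(k < n) h k x).

Lemma cutoff_eq1 (R : realType) (K : Type) (h : nat -> K -> R) n (x : K) :
  (forall k, h k x = 0) -> cutoff h n x = 1.
Proof.
by move=> hx; rewrite /cutoff big1// mulr0 subr0 max_r// ler01.
Qed.

Lemma cutoff_near0 (R : realType) (K : Type) (h : nat -> K -> R) (x : K) :
  (forall k, 0 <= h k x) -> ~ (forall k, h k x = 0) ->
  \forall n \near \oo, cutoff h n x = 0.
Proof.
move=> h0 /existsNP[k /eqP hk].
have hk0 : 0 < h k x by rewrite lt_def hk h0.
near=> n; rewrite /cutoff max_l// subr_le0.
have kn : (k < n)%N by near: n; exact: nbhs_infty_gt.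
apply: (@le_trans _ _ (n%:R * h k x)).
  rewrite -ler_pdivrMr// mul1r; near: n.
  exact: nbhs_infty_ger.
rewrite ler_wpM2l// (bigD1 (Ordinal kn))//= lerDl.
by apply: sumr_ge0.
Unshelve. all: by end_near. Qed.

Lemma continuous_sumr (R : realType) (K : topologicalType) n
    (f : nat -> K -> R) : (forall i, continuous (f i)) ->
  continuous (fun x => \sum_(i < n) f i x).
Proof.
move=> fc; apply: (continuous_big (P := xpredT)) => [|i _]; last exact: fc.
exact: add_continuous.
Qed.

Lemma continuous_prodr (R : realType) (K : topologicalType) n
    (f : nat -> K -> R) : (forall i, continuous (f i)) ->
  continuous (fun x => \prod_(i < n) f i x).
Proof.
move=> fc; apply: (continuous_big (P := xpredT)) => [|i _]; last exact: fc.
exact: mul_continuous.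
Qed.

Lemma continuous_max0r (R : realType) (K : topologicalType) (f : K -> R) :
  continuous f -> continuous (fun x => Num.max 0 (f x)).
Proof.
move=> fc x.
exact: (@continuous_max _ _ (fun=> 0) f x (@cst_continuous _ _ 0 x) (fc x)).
Qed.

Lemma cutoff_continuous (R : realType) (K : topologicalType)
    (h : nat -> K -> R) n :
  (forall k, continuous (h k)) -> continuous (cutoff h n).
Proof.
move=> hc; apply: continuous_max0r => x.
apply: cvgB; first exact: cvg_cst.
by apply: cvgM; [exact: cvg_cst|exact: continuous_sumr].
Qed.

Lemma first_value_sum_continuous (R : realType) (K : topologicalType)
    (c : nat -> R) (phi : nat -> K -> R) m :
  (forall i, continuous (phi i)) ->
  continuous (fun x => first_value_sum c (phi ^~ x) m).
Proof.
move=> phic.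
apply: (@continuous_sumr _ _ m
  (fun i x => c i * phi i x * \prod_(j < i) (1 - phi j x))) => i x.
apply: cvgM.
  by apply: cvgM; [exact: cvg_cst|exact: phic].
apply: (@continuous_prodr _ _ i (fun j x => 1 - phi j x)) => j y.
by apply: cvgB; [exact: cvg_cst|exact: phic].
Qed.

(** If countably many sets, each the common zero set of a sequence of continuous
    functions, cover the space, and the [i]-th one is assigned the value [c i],
    then some discrete limit of continuous functions takes at each point the
    value assigned to a set that contains it. *)
Lemma discrete_limit_first_value (R : realType) (K : topologicalType)
    (c : nat -> R) (h : nat -> nat -> K -> R) :
  (forall i k, continuous (h i k)) -> (forall i k x, 0 <= h i k x) ->
  (forall x, exists i, forall k, h i k x = 0) ->
  exists2 G : K -> R, discrete_limit G &
    forall x, exists2 i, (forall k, h i k x = 0) & G x = c i.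
Proof.
move=> hc h0 hcov.
have first x : exists i, (forall k, h i k x = 0) /\
    forall j, (j < i)%N -> ~ (forall k, h j k x = 0).
  have ex : exists i, `[< forall k, h i k x = 0 >].
    by have [i hi] := hcov x; exists i; exact/asboolP.
  have [i /asboolP hi imin] := ex_minnP ex.
  exists i; split=> // j ji /asboolP /imin.
  by rewrite leqNgt ji.
have [idx idxP] := choice first.
exists (c \o idx) => [|x]; last by exists (idx x) => //; case: (idxP x).
exists (fun n x => first_value_sum c (fun i => cutoff (h i) n x) n) => [n|x].
  apply: (@first_value_sum_continuous _ _ c (fun i => cutoff (h i) n)) => i.
  exact: cutoff_continuous.
have [hx hlt] := idxP x.
have off : \forall n \near \oo, forall j : 'I_(idx x), cutoff (h j) n x = 0.
  by apply: filter_forall => j; apply: cutoff_near0 => //; exact: hlt.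
near=> n; apply: first_value_sumE; first by near: n; exact: nbhs_infty_gt.
  exact: cutoff_eq1.
move=> j jlt.
have offn : forall i : 'I_(idx x), cutoff (h i) n x = 0 by near: n.
exact: (offn (Ordinal jlt)).
Unshelve. all: by end_near. Qed.

(** * Approximation by functions with values in [e Z] *)

Lemma discrete_multiples (R : realType) (e : R) (A : set R) : 0 < e ->
  (forall y, A y -> exists j : int, y = j%:~R * e) -> discrete_subset A.
Proof.
move=> e0 Amul y Ay /(_ _ (nbhsx_ballx y e e0))[z [zy Az]].
have [[j yE] [k zE]] := (Amul y Ay, Amul z Az).
rewrite /ball /= yE zE -mulrBl normrM (gtr0_norm e0) gtr_pMl//.
rewrite -intrB -intr_norm ltrz1 -[1 : int]add0r ltzD1 normr_le0 subr_eq0.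
move=> /eqP jkE; move: zy.
by rewrite zE yE jkE eqxx.
Qed.

Lemma baire_one_approx (R : realType) (K : topologicalType) (F : K -> R)
    (e : R) : baire_one F -> 0 < e ->
  exists G : K -> R, [/\ discrete_limit G, discrete_subset (range G) &
    forall x, `|F x - G x| <= e].
Proof.
case=> f_ fc fF e0.
(* An enumeration of the pairs [(j, N)]; codes of no pair get the harmless
   default [(0, 0)]. *)
pose lab i : int * nat := odflt (0, 0%N) (unpickle i).
pose c i : R := (lab i).1%:~R * e.
(* Its zeros in [x], over all [k], are the points with
   [`|f_ n x - c i| <= e] for all [n >= (lab i).2]. *)
pose h i k x : R := Num.max 0 (`|f_ ((lab i).2 + k)%N x - c i| - e).
have hc i k : continuous (h i k).
  apply: continuous_max0r => x.
  apply: cvgB; last exact: cvg_cst.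
  apply: (@continuous_comp _ _ _ (fun y => f_ _ y - c i)); last first.
    exact: norm_continuous.
  by apply: cvgB; [exact: fc|exact: cvg_cst].
have h0 i k x : 0 <= h i k x by rewrite /h le_max lexx.
have hP i k x : h i k x = 0 <-> `|f_ ((lab i).2 + k)%N x - c i| <= e.
  rewrite -subr_le0 /h; split=> [<-|/max_l//].
  by rewrite le_max lexx orbT.
have hcov x : exists i, forall k, h i k x = 0.
  (* The inequality [`|F x - j e| < e] is strict, so it passes to [f_ n x] for
     large [n]. *)
  pose j := Num.floor (F x / e).
  have Fj : `|F x - j%:~R * e| < e.
    have /andP[] := floor_itv (F x / e); rewrite -/j.
    rewrite ler_pdivlMr// ltr_pdivrMr// intrD mulrDl mul1r => jF Fj.
    by rewrite ger0_norm ?subr_ge0// ltrBlDl.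
  have fl : (f_ n x - j%:~R * e) @[n --> \oo] --> F x - j%:~R * e.
    by apply: cvgB; [exact: fF|exact: cvg_cst].
  have [N _ fN] := cvgr_norm_le _ fl _ Fj.
  exists (pickle (j, N)) => k; apply/hP.
  by rewrite /c /lab pickleK /=; apply: fN => /=; exact: leq_addr.
have [G Glim Gc] := discrete_limit_first_value c hc h0 hcov.
exists G; split=> [//| |x].
  apply: (discrete_multiples e0) => _ [x _ <-].
  by have [i _ ->] := Gc x; exists (lab i).1.
have [i hi ->] := Gc x.
have fl : (`|f_ n x - c i|) @[n --> \oo] --> `|F x - c i|.
  by apply: cvg_norm; apply: cvgB; [exact: fF|exact: cvg_cst].
apply: (cvgr_to_le fl).
near=> n; have Nn : ((lab i).2 <= n)%N by near: n; exact: nbhs_infty_ge.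
by have /hP := hi (n - (lab i).2)%N; rewrite subnKC.
Unshelve. all: by end_near. Qed.

Unset Implicit Arguments.
Set Strict Implicit.

Theorem corollary3p5 (R : realType) (K : topologicalType) (hK : polish R K) :
  (forall F : K -> R, baire_one F ->
     exists2 s : nat -> K -> R,
       forall n, step_function (s n) & {uniform, s @ \oo --> F}) /\
  (forall f : K -> R, baire_one f -> forall eps : R, 0 < eps ->
     exists2 g : K -> R, DSC g &
       (ereal_sup [set (`|f x - g x|)%:E | x in [set: K]] <= eps%:E)%E).
Proof.
split=> [F bF|f bf eps eps0]; last first.
  have [G [Glim _ GF]] := baire_one_approx bf eps0.
  exists G; first exact: discrete_limit_DSC.
  by apply: ge_ereal_sup => _ [x _ <-]; rewrite lee_fin.
have inv0 n : 0 < n.+1%:R^-1 :> R by rewrite invr_gt0 ltr0n.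
have [s sP] := choice (fun n => baire_one_approx bF (inv0 n)).
exists s => [n|].
  by have [slim sdisc _] := sP n; split=> //; exact: discrete_limit_baire_one.
move=> P /uniform_nbhs[E [entE EP]].
move: entE; rewrite -entourage_ballE => -[e /= e0 eE].
near=> n; apply: EP => x _; apply: eE => /=.
rewrite /ball /=; have [_ _ /(_ x) sF] := sP n.
apply: le_lt_trans sF _.
by near: n; exact: (near_infty_natSinv_lt (PosNum e0)).
Unshelve. all: by end_near. Qed.
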